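(* Let $b\geq2$ be an integer and let $f:\mathbb{N}\to\mathbb{R}_+$ be a non-increasing mapping with $f(q)\to0$ as $q\to+\infty$. Then, for any $N\in\mathbb{N}$, $$\lim_{x\to+\infty}\frac{\log\#\{1\leq q\leq x:\ \gcd(q,b)=1,\ \omega(q)\leq N,\ O_q(b)\leq q^{f(q)}\}}{\log x}=0.$$
   Context: For an integer $q\ge1$, $\omega(q)$ is the number of distinct prime factors of $q$ (so $\omega(1)=0$). For $\gcd(q,b)=1$, $O_q(b)=\min\{k\geq1:\ b^k\equiv1\bmod q\}$ is the multiplicative order of $b$ modulo $q$. *)

(* Defs.v *)
From mathcomp Require Import all_boot all_order all_algebra finmap.
From mathcomp Require Import all_classical all_reals all_analysis.
From mathcomp Require cyclic.

Set Implicit Arguments.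
Unset Strict Implicit.
Unset Printing Implicit Defensive.

Import Order.TTheory GRing.Theory Num.Theory.
Import numFieldNormedType.Exports.

Local Open Scope classical_set_scope.
Local Open Scope ring_scope.

Definition omega (q : nat) : nat := size (primes q).

                                                                 
                                                                           
Definition mult_order (q b : nat) : nat :=
  match pselect (exists k : nat, (1 <= k)%N && (b ^ k == 1 %[mod q])%N) with
  | left exk => ex_minn exk
  | right _ => 0%N
  end.

Lemma mult_orderP (q b : nat) : (1 <= q)%N -> coprime q b ->
  [/\ (1 <= mult_order q b)%N,
      (b ^ mult_order q b = 1 %[mod q])%N
    & forall k : nat, (1 <= k)%N -> (b ^ k = 1 %[mod q])%N ->
        (mult_order q b <= k)%N].
Proof.
move=> q_gt0 co_qb; rewrite /mult_order; case: pselect => [exk|[]].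
  case: ex_minnP => m /andP[m_gt0 /eqP bm1] min_m; split=> // k k_gt0 bk1.
  by apply: min_m; rewrite k_gt0 bk1 eqxx.
exists (totient q); rewrite totient_gt0 q_gt0 /=.
by apply/eqP/cyclic.Euler_exp_totient; rewrite coprime_sym.
Qed.

Definition small_order_set (R : realType) (b : nat) (f : nat -> R) (N : nat)
    (x : R) : set nat :=
  [set q : nat | [/\ (1 <= q)%N /\ q%:R <= x,
                     gcdn q b = 1%N,
                     (omega q <= N)%N
                   & (mult_order q b)%:R <= q%:R `^ f q]].

                                                                        
Lemma finite_small_order_set (R : realType) (b : nat) (f : nat -> R) (N : nat)
  (x : R) : finite_set (small_order_set b f N x).
Proof.
apply: (sub_finite_set _ (finite_II (Num.truncn x).+1)).
move=> q [[_ le_qx] _ _ _] /=; rewrite ltnS.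
have x_ge0 : 0 <= x by apply: le_trans le_qx.
by rewrite truncn_ge_nat.
Qed.

(* Main.v *)
Require Import Defs.
From mathcomp Require Import all_boot all_order all_algebra finmap.
From mathcomp Require Import all_classical all_reals all_analysis.
From mathcomp Require Import zify.

Import Order.TTheory GRing.Theory Num.Theory.
Import numFieldNormedType.Exports.

(** The set in question grows slower than any power of [x] because an integer
    of small order has very few candidates for its prime power components.

    Suppose that [q] is coprime to [b] and that [O_q(b) = k] with
    [1 <= k <= K]. Then [q] divides [b ^ k - 1], hence so does each component
    [p ^ v_p(q)]. A positive integer [n < 2 ^ m] has at most [m] prime power
    divisors other than 1, because their number is the sum of the [v_p(n)] and
    each unit of that sum contributes a factor at least 2 to [n]. Since
    [b ^ k - 1 < 2 ^ (b * k)], at most [b * K ^ 2] prime powers can occur for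
    all [k <= K] together. An integer with [omega q <= N] is a product of [N]
    factors, each equal to 1 or to one of these prime powers, so that there are
    at most [(b * K ^ 2 + 1) ^ N] such [q] ([mem_small_order_candidates],
    [size_small_order_candidates]).

    Given [d > 0], all but finitely many [q] satisfy [f q <= d]; those of them
    that belong to the set have order at most [q ^ d <= x ^ d], and taking
    [K = x ^ d] above bounds their number by [C * x ^ (2 * N * d)]
    ([card_small_order_set_le]). As [d] is arbitrary the upper limit is at most
    0; and the quotient is nonnegative for [x > 1] because [q = 1] always
    belongs to the set. *)

(** * Prime power divisors *)

Definition prime_power_divisors (n : nat) : seq nat :=
  [seq (pe.1 ^ i)%N | pe <- prime_decomp n, i <- iota 1 pe.2].

Lemma mem_prime_power_divisors (n p e : nat) :
  (0 < n)%N -> prime p -> (0 < e)%N -> (p ^ e %| n)%N ->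
  (p ^ e)%N \in prime_power_divisors n.
Proof.
move=> n_gt0 p_pr e_gt0 pe_n.
have le_e : (e <= logn p n)%N by rewrite -pfactor_dvdn.
apply/allpairsPdep; exists (p, logn p n), e; split=> //.
  rewrite prime_decompE; apply: map_f.
  by rewrite -logn_gt0 (leq_trans e_gt0).
by rewrite mem_iota e_gt0 add1n ltnS.
Qed.

(** The number of prime power divisors is the sum of the [v_p(n)], and
    [2 ^ v_p(n) <= p ^ v_p(n)]. *)
Lemma size_prime_power_divisors (n m : nat) :
  (0 < n)%N -> (n < 2 ^ m)%N -> (size (prime_power_divisors n) <= m)%N.
Proof.
move=> n_gt0 lt_n; rewrite size_allpairs_dep sumnE big_map.
under eq_bigr do rewrite size_iota.
rewrite -(leq_exp2l (m := 2)) // ltnW //; apply: leq_ltn_trans lt_n.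
rewrite [leqRHS]prod_prime_decomp // expn_sum big_seq [leqRHS]big_seq.
apply: leq_prod => -[p e] /mem_prime_decomp[p_pr e_gt0 _] /=.
by rewrite leq_exp2r // prime_gt1.
Qed.

(** * Products of a bounded number of factors *)

Definition products (n : nat) (s : seq nat) : seq nat :=
  iter n (fun t => [seq (u * v)%N | u <- s, v <- t]) [:: 1%N].

Lemma size_products (n : nat) (s : seq nat) :
  size (products n s) = (size s ^ n)%N.
Proof. by elim: n => //= n IHn; rewrite size_allpairs IHn expnS. Qed.

(** As 1 is an admissible factor, shorter products can be padded to length [n]. *)
Lemma mem_products (I : eqType) (n : nat) (s : seq nat) (r : seq I)
    (F : I -> nat) :
  1%N \in s -> (size r <= n)%N -> {in r, forall i, F i \in s} ->
  (\prod_(i <- r) F i)%N \in products n s.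
Proof.
move=> s1; elim: n r => [|n IHn] [|i r] //= le_r Fs.
- by rewrite big_nil.
- by move: (IHn [::]); rewrite !big_nil => IH; exact: (allpairs_f muln s1 (IH isT _)).
- rewrite big_cons allpairs_f ?Fs ?mem_head // IHn // => j rj.
  by rewrite Fs // in_cons rj orbT.
Qed.

(** * Integers modulo which [b] has small order *)

Definition small_order_prime_powers (b K : nat) : seq nat :=
  flatten [seq prime_power_divisors (b ^ k - 1) | k <- iota 1 K].

Definition small_order_candidates (b K N : nat) : seq nat :=
  products N (1%N :: small_order_prime_powers b K).

Lemma mem_small_order_candidates (b K N q : nat) :
  (2 <= b)%N -> (1 <= q)%N -> coprime q b -> (omega q <= N)%N ->
  (mult_order q b <= K)%N -> q \in small_order_candidates b K N.
Proof.
move=> b_gt1 q_gt0 co_qb omega_q le_K.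
have [k_gt0 bk1 _] := mult_orderP q_gt0 co_qb.
set k := mult_order q b in le_K k_gt0 bk1.
have bk_gt1 : (1 < b ^ k)%N by rewrite -{1}(expn0 b) ltn_exp2l.
have q_dvd : (q %| b ^ k - 1)%N by rewrite -eqn_mod_dvd ?(ltnW bk_gt1) //; apply/eqP.
rewrite [q]prod_prime_decomp // prime_decompE big_map.
apply: mem_products; rewrite ?mem_head // => p /=.
rewrite mem_primes => /and3P[p_pr _ p_q].
rewrite in_cons; apply/orP; right; apply/flatten_mapP; exists k.
  by rewrite mem_iota k_gt0 add1n ltnS.
apply: mem_prime_power_divisors; rewrite ?subn_gt0 //.
  by rewrite logn_gt0 mem_primes p_pr q_gt0.
exact: dvdn_trans (pfactor_dvdnn _ _) q_dvd.
Qed.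

Lemma size_small_order_candidates (b K N : nat) : (2 <= b)%N ->
  (size (small_order_candidates b K N) <= (b * K ^ 2 + 1) ^ N)%N.
Proof.
move=> b_gt1; rewrite size_products; case: N => // N; rewrite leq_exp2r //=.
rewrite addn1 ltnS size_flatten /shape -map_comp sumnE big_map.
have -> : (b * K ^ 2 = \sum_(k <- iota 1 K) b * K)%N.
  by rewrite big_const_seq count_predT size_iota iter_addn_0 -mulnA mulnn.
rewrite big_seq [leqRHS]big_seq; apply: leq_sum => k.
rewrite mem_iota add1n ltnS => /andP[k_gt0 le_K].
have bk_gt1 : (1 < b ^ k)%N by rewrite -{1}(expn0 b) ltn_exp2l.
apply: size_prime_power_divisors; first by rewrite subn_gt0.
rewrite subn1 prednK ?(ltnW bk_gt1) // expnM.
(* Crude but sufficient: [b <= 2 ^ b] replaces [log_2 b] by [b]. *)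
apply: (@leq_trans ((2 ^ b) ^ k)); last by rewrite leq_pexp2l // expn_gt0.
by rewrite leq_exp2r // ltnW // ltn_expl.
Qed.

(** * The counting function *)

Local Open Scope classical_set_scope.
Local Open Scope ring_scope.

Lemma card_fset_set_le_size (T : choiceType) (A : set T) (s : seq T) :
  A `<=` [set` s] -> (#|` fset_set A| <= size s)%N.
Proof.
move=> As; have finA : finite_set A by apply: sub_finite_set As _; exact: finite_seq.
apply: uniq_leq_size; first exact: fset_uniq.
move=> u uA; apply: As; move: uA; rewrite in_fset_set //.
by rewrite inE.
Qed.

Section Counting.
Context {R : realType}.
Implicit Types (f : nat -> R) (x d : R) (b N : nat).

Lemma one_in_small_order_set b f N x : 1 <= x -> small_order_set b f N x 1%N.
Proof.
move=> x_ge1; split=> //=; first by rewrite gcd1n.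
have [_ _ min_1] := @mult_orderP 1 b isT (coprime1n b).
by rewrite powR1 lern1 min_1 // !modn1.
Qed.

(** With [K] the integer part of [x ^ d], the members of the set that are at
    least [q0] are among the candidates for [K], whose number is polynomial in
    [K]; the integers below [q0], where [f] may exceed [d], are all counted and
    only enlarge the constant. *)
Lemma card_small_order_set_le b f N (q0 : nat) d x : (2 <= b)%N ->
  (forall q, (q0 <= q)%N -> f q <= d) -> 0 <= d -> 1 <= x ->
  (#|` fset_set (small_order_set b f N x)|%:R : R) <=
    (q0.+1 * b.+1 ^ N)%:R * x `^ (d *+ (2 * N)).
Proof.
move=> b_gt1 f_le d_ge0 x_ge1.
have x_ge0 : 0 <= x by apply: le_trans x_ge1.
set K := Num.truncn (x `^ d).
have K_le : K%:R <= x `^ d by rewrite truncn_le ?powR_ge0.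
have xd_ge1 : 1 <= x `^ d by rewrite -(powRr0 x) ler_powR.
have K_gt0 : (0 < K)%N by rewrite truncn_gt0.
have card_le : (#|` fset_set (small_order_set b f N x)| <=
                  q0 + (b * K ^ 2 + 1) ^ N)%N.
  apply: (@leq_trans (size (iota 0 q0 ++ small_order_candidates b K N))).
    apply: card_fset_set_le_size => q [[q_gt0 q_le] co_qb omega_q ord_q].
    rewrite /= mem_cat mem_iota add0n /=; case: ltnP => //= q0_le.
    apply: mem_small_order_candidates => //; first exact/eqP.
    rewrite -(ler_nat R) in q_gt0.
    rewrite /K truncn_ge_nat ?powR_ge0 //; apply: le_trans ord_q _.
    apply: (@le_trans _ _ (q%:R `^ d)); first by rewrite ler_powR ?f_le.
    by rewrite ge0_ler_powR ?nnegrE.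
  by rewrite size_cat size_iota leq_add2l size_small_order_candidates.
have nat_le : (q0 + (b * K ^ 2 + 1) ^ N <= q0.+1 * b.+1 ^ N * K ^ (2 * N))%N.
  have K2_gt0 : (0 < K ^ 2)%N by rewrite expn_gt0 K_gt0.
  rewrite -mulnA expnM -expnMn mulSn addnC leq_add //.
    by case: N {card_le} => // N; rewrite leq_exp2r // mulSn addnC leq_add2r.
  by rewrite -[leqLHS]muln1 leq_mul // expn_gt0 muln_gt0 K2_gt0.
apply: (@le_trans _ _ (q0.+1 * b.+1 ^ N * K ^ (2 * N))%:R).
  by rewrite ler_nat (leq_trans card_le).
rewrite natrM ler_wpM2l // natrX -(mulr_natr d) powRrM powR_mulrn ?powR_ge0 //.
by rewrite lerXn2r ?nnegrE ?powR_ge0.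
Qed.

End Counting.

Theorem theorem1p6 (R : realType) (b : nat) (hb : (2 <= b)%N)
    (f : nat -> R) (f_ge0 : forall q : nat, 0 <= f q)
    (f_noninc : nonincreasing_seq f) (f_cvg0 : f q @[q --> \oo] --> 0)
    (N : nat) :
  ln (#|` fset_set (small_order_set b f N x)|%:R) / ln x @[x --> +oo]
    --> (0 : R).
Proof.
apply/cvgrPdist_le => eps eps_gt0.
(* With this exponent the bound [x ^ (2 * N * d)] accounts for at most [eps / 2]. *)
set d : R := eps / (4 * N.+1%:R).
have d_gt0 : 0 < d by rewrite divr_gt0 ?mulr_gt0.
have [q0 _ f_le] : \forall q \near \oo, f q <= d.
  move/cvgrPdist_le: f_cvg0 => /(_ d d_gt0); apply: filterS => q.
  by rewrite sub0r normrN ger0_norm.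
have d2N : d *+ (2 * N) <= eps / 2.
  rewrite -(mulr_natr d) /d ler_pdivlMr // -mulrA mulrAC ler_pdivrMr ?mulr_gt0 //.
  by rewrite ler_pM2l // -!natrM ler_nat; lia.
set C : R := (q0.+1 * b.+1 ^ N)%:R.
have C_gt0 : 0 < C by rewrite ltr0n muln_gt0 expn_gt0.
near=> x.
have x_gt1 : 1 < x by near: x; exact: nbhs_pinfty_gt.
have x_gt0 : 0 < x by apply: lt_trans x_gt1.
have lnx_gt0 : 0 < ln x by rewrite ln_gt0.
(* For large [x] the constant [C] is absorbed into the other [eps / 2]. *)
have lnC_le : ln C <= eps / 2 * ln x.
  by rewrite -ler_pdivrMl ?divr_gt0 // -ler_expR lnK ?posrE //.
set c := #|` _|.
have c_gt0 : (0 < c)%N.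
  rewrite cardfs_gt0; apply/fset0Pn; exists 1%N.
  rewrite in_fset_set ?inE; last exact: finite_small_order_set.
  exact/one_in_small_order_set/ltW.
have lnc_ge0 : 0 <= ln (c%:R : R) by rewrite ln_ge0 // ler1n.
rewrite sub0r normrN ger0_norm ?divr_ge0 ?(ltW lnx_gt0) // ler_pdivrMr //.
have c_le : c%:R <= C * x `^ (d *+ (2 * N)).
  by apply: card_small_order_set_le => //; exact: ltW.
apply: (@le_trans _ _ (ln (C * x `^ (d *+ (2 * N))))).
  by rewrite ler_ln ?posrE ?ltr0n // mulr_gt0 // powR_gt0.
rewrite lnM ?posrE ?powR_gt0 // ln_powR.
by rewrite [eps]splitr mulrDl lerD // ler_wpM2r // ltW.
Unshelve. all: by end_near. Qed.
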